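(* Let $n\geq 4$ and $2\leq m\leq n-2$. Then $\kappa(Q_n;C_{2^m})=n-m$ if $n\in\{4,5\}$ or if $m=2$; and if $n\geq 6$ and $3\leq m\leq n-2$, then $\kappa(Q_n;C_{2^m})=\lceil\frac{n}{2^{m-1}}\rceil<n-m$.
   Context: $Q_n$ is the $n$-dimensional hypercube: its vertices are the binary strings of length $n$, two vertices being adjacent iff they differ in exactly one position. $C_k$ denotes the cycle of length $k$. For connected graphs $G,H$, an $H$-structure cut of $G$ is a set $F$ of subgraphs of $G$, each isomorphic to $H$, such that $G-V(F)$ is disconnected or trivial (a single vertex); $\kappa(G;H)$ is the minimum cardinality of an $H$-structure cut of $G$. *)

(* Defs.v *)
From mathcomp Require Import all_boot all_order all_algebra.

Set Implicit Arguments.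
Unset Strict Implicit.
Unset Printing Implicit Defensive.


Record sgraph := SGraph {
  vert :> finType;
  adj : rel vert;
  adj_sym : symmetric adj;
  adj_irr : irreflexive adj }.

Definition isomorphic (G H : sgraph) : Prop :=
  exists f : G -> H, bijective f /\ forall x y : G, adj (f x) (f y) = adj x y.

Definition disconnected (G : sgraph) : Prop :=
  exists x y : G, ~~ connect (@adj G) x y.

Definition trivial_graph (G : sgraph) : Prop := #|G| = 1.

Definition edge_set (G : sgraph) : {set {set G}} :=
  [set [set p.1; p.2] | p : G * G & adj p.1 p.2].

Section Subgraphs.
Variable G : sgraph.

(* A subgraph is a pair (vertex set, edge set), not necessarily induced, so two
   subgraphs with the same vertices but different edges are distinct. *)
Definition is_subgraph (S : {set G} * {set {set G}}) : bool :=
  (S.2 \subset edge_set G) && (cover S.2 \subset S.1).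

Definition subgraph := {S : {set G} * {set {set G}} | is_subgraph S}.

Definition sub_verts (S : subgraph) : {set G} := (val S).1.
Definition sub_edges (S : subgraph) : {set {set G}} := (val S).2.

Section AsGraph.
Variable S : subgraph.

Definition sub_adj (x y : {z : G | z \in sub_verts S}) : bool :=
  [set val x; val y] \in sub_edges S.

Lemma sub_adj_sym : symmetric sub_adj.
Proof. by move=> x y; rewrite /sub_adj setUC. Qed.

Lemma sub_adj_irr : irreflexive sub_adj.
Proof.
move=> x; apply/negP; rewrite /sub_adj setUid => xE.
have /andP [/subsetP sE _] := valP S.
have /imsetP [[a b]] := sE _ xE; rewrite inE /= => ab eqab.
have: a \in [set val x] by rewrite eqab set21.
have: b \in [set val x] by rewrite eqab set22.
by move=> /set1P b_x /set1P a_x; rewrite a_x b_x adj_irr in ab.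
Qed.

Definition graph_of_subgraph : sgraph := SGraph sub_adj_sym sub_adj_irr.

End AsGraph.

Section Induced.
Variable A : {set G}.

Definition induced_adj (x y : {z : G | z \in A}) : bool := adj (val x) (val y).

Lemma induced_adj_sym : symmetric induced_adj.
Proof. by move=> x y; apply: adj_sym. Qed.

Lemma induced_adj_irr : irreflexive induced_adj.
Proof. by move=> x; apply: adj_irr. Qed.

Definition induced : sgraph := SGraph induced_adj_sym induced_adj_irr.

End Induced.

Definition family_verts (F : {set subgraph}) : {set G} :=
  \bigcup_(S in F) sub_verts S.

Definition remove_family (F : {set subgraph}) : sgraph :=
  induced (~: family_verts F).

(* When the family covers all of [G], the empty remainder is neither
   disconnected nor trivial. *)
Definition structure_cut (H : sgraph) (F : {set subgraph}) : Prop :=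
  (forall S, S \in F -> isomorphic (graph_of_subgraph S) H) /\
  (disconnected (remove_family F) \/ trivial_graph (remove_family F)).

End Subgraphs.

(* [kappa_eq G H k] reads "kappa(G; H) = k": the minimum is attained, so the
   relation holds for no [k] when [G] has no [H]-structure cut. *)
Definition kappa_eq (G H : sgraph) (k : nat) : Prop :=
  (exists F : {set subgraph G}, structure_cut H F /\ #|F| = k) /\
  (forall F : {set subgraph G}, structure_cut H F -> k <= #|F|).

Section Hypercube.
Variable n : nat.

Definition cube_adj (x y : n.-tuple bool) : bool :=
  #|[set i : 'I_n | tnth x i != tnth y i]| == 1.

Lemma cube_adj_sym : symmetric cube_adj.
Proof.
move=> x y; rewrite /cube_adj; congr (#|pred_of_set _| == 1).
by apply/setP => i; rewrite !inE eq_sym.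
Qed.

Lemma cube_adj_irr : irreflexive cube_adj.
Proof.
move=> x; rewrite /cube_adj (_ : [set i | _] = set0) ?cards0 //.
by apply/setP => i; rewrite !inE eqxx.
Qed.

Definition hypercube : sgraph := SGraph cube_adj_sym cube_adj_irr.

End Hypercube.

Section Cycle.
Variable k : nat.

(* [ordS] is the successor modulo [k]; the conjunct [x != y] only matters for
   the degenerate case [k = 1]. *)
Definition cycle_adj (x y : 'I_k) : bool :=
  (x != y) && ((ordS x == y) || (ordS y == x)).

Lemma cycle_adj_sym : symmetric cycle_adj.
Proof. by move=> x y; rewrite /cycle_adj eq_sym orbC. Qed.

Lemma cycle_adj_irr : irreflexive cycle_adj.
Proof. by move=> x; rewrite /cycle_adj eqxx. Qed.

Definition cycle_graph : sgraph := SGraph cycle_adj_sym cycle_adj_irr.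

End Cycle.

(* The ceiling of the rational number a / b, as a natural number. *)
Definition ceil_ratio (a b : nat) : nat :=
  `|Num.ceil (a%:R / b%:R : rat)%R|%N.

(* Main.v *)
(* A cycle of length 2q contains at most q neighbours of a vertex, so isolating
   a vertex takes n/q cycles.  This is attained by cycles running alternately
   through neighbours of the origin and vertices of weight 2 (with a detour
   through a subcube when n < q).  Conversely, fewer than n/q cycles remove at
   most n - 1 vertices of each parity, hence isolate no vertex, and every removed
   vertex has two removed neighbours.  Split the cube along a direction so that
   one half minus the cycles is connected: a vertex not linked to that half has
   its partner removed, and counting the removed vertices over the neighbourhood
   of an edge of such vertices gives more than 2n - 2 of them.

   For q = 2 the cycles are subcubes of dimension 2, and the stronger bound n - 2
   comes from an induction: in a direction not spanned by the first subcube, the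
   other half meets fewer subcubes, and if every subcube meets the half of the
   first one, then a vertex whose partner is removed is itself removed. *)

Require Import Defs.
From mathcomp Require Import all_boot all_order all_algebra.
From mathcomp Require Import zify.

Set Implicit Arguments.
Unset Strict Implicit.
Unset Printing Implicit Defensive.

(** * Connectedness of a vertex set and of the graph it induces *)

(** Stating connectedness through two-colourings avoids handling paths; the empty set counts as
    connected. *)
Definition connected_on (T : finType) (e : rel T) (V : {set T}) : Prop :=
  forall c : T -> bool, {in V &, forall x y, e x y -> c x = c y} ->
  {in V &, forall x y, c x = c y}.

Lemma connected_on_induced (G : sgraph) (A : {set G}) :
  connected_on (@adj G) A -> ~ disconnected (induced A).
Proof.
move=> conA [x [y]] /negP; apply.
(* The colouring marks the vertices reachable from [x] inside [A]; its value outside [A] is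
   arbitrary. *)
pose c (z : G) := if insub z is Some u then connect (@adj (induced A)) x u else false.
have cE (u : {z : G | z \in A}) : c (val u) = connect (@adj (induced A)) x u.
  by rewrite /c valK.
rewrite -cE (conA c _ _ (val x) (valP y) (valP x)) ?cE ?connect0 //.
move=> u v uA vA uv; rewrite -[u](SubK {z : G | z \in A} uA).
rewrite -[v](SubK {z : G | z \in A} vA) !cE.
have euv : @adj (induced A) (Sub u uA) (Sub v vA) by rewrite /= /induced_adj.
apply/idP/idP => xu; apply: connect_trans xu (connect1 _) => //.
by rewrite adj_sym.
Qed.

Lemma disconnected_induced (G : sgraph) (A P : {set G}) (x y : G) :
  {in A & A, forall u v, adj u v -> u \in P -> v \in P} ->
  x \in A -> x \in P -> y \in A -> y \notin P -> disconnected (induced A).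
Proof.
move=> clP xA xP yA yP.
exists (Sub x xA : {z | z \in A}), (Sub y yA : {z | z \in A}).
have clo : closed (@adj (induced A)) [pred u : {z | z \in A} | val u \in P].
  move=> u v uv; rewrite !inE; apply/idP/idP; apply: clP; rewrite ?(valP u) ?(valP v) //.
  by rewrite adj_sym.
apply/negP => /(closed_connect clo); rewrite !inE /= xP => /esym yP'.
by rewrite yP' in yP.
Qed.

Lemma count_lt (T : eqType) (p q : pred T) (s : seq T) (x : T) :
  subpred p q -> x \in s -> q x -> ~~ p x -> count p s < count q s.
Proof.
move=> pq xs qx px; have [s1 [s2 ->]] : exists s1 s2, s = s1 ++ x :: s2.
  by case/splitPr: xs => s1 s2; exists s1, s2.
by rewrite !count_cat /= qx (negbTE px) -addnS leq_add ?ltnS ?sub_count.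
Qed.

(** * Flips, parity and subcubes of the hypercube *)

Section Cube.
Variable n : nat.
Local Notation cube := (n.-tuple bool).
Implicit Types (x y a u v w : cube) (i j k l : 'I_n) (S R : {set 'I_n}).
Implicit Types (X Y D : {set cube}) (fs : seq ({set 'I_n} * cube)).

Definition flip i x : cube := [tuple (k == i) (+) tnth x k | k < n].

Lemma tnth_flip i x k : tnth (flip i x) k = (k == i) (+) tnth x k.
Proof. by rewrite tnth_mktuple. Qed.

Lemma flipK i : involutive (flip i).
Proof. by move=> x; apply: eq_from_tnth => k; rewrite !tnth_flip addbA addbb. Qed.

Lemma flipC i j x : flip i (flip j x) = flip j (flip i x).
Proof. by apply: eq_from_tnth => k; rewrite !tnth_flip addbCA. Qed.

Lemma flip_injl x : injective (flip^~ x).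
Proof.
move=> i j /(congr1 (fun z => tnth z i)); rewrite !tnth_flip eqxx.
by case: eqP => // _; case: (tnth _ _).
Qed.

Lemma flip_neq i x : (flip i x == x) = false.
Proof.
by apply/eqP => /(congr1 (fun z => tnth z i)); rewrite tnth_flip eqxx; case: (tnth _ _).
Qed.

Lemma cube_adjP x y : reflect (exists i, y = flip i x) (cube_adj x y).
Proof.
apply: (iffP cards1P) => [[i /setP di]|[i ->]]; exists i.
  apply: eq_from_tnth => k; rewrite tnth_flip; have := di k; rewrite !inE => <-.
  by case: (tnth _ _); case: (tnth _ _).
by apply/setP => k; rewrite !inE tnth_flip; case: (k == i); case: (tnth _ _).
Qed.

Lemma cube_adj_flip i x : cube_adj x (flip i x).
Proof. by apply/cube_adjP; exists i. Qed.

Definition parity x : bool := \big[addb/false]_k tnth x k.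

Lemma parity_flip i x : parity (flip i x) = ~~ parity x.
Proof.
rewrite /parity (bigD1 i) //= [in RHS](bigD1 i) //= tnth_flip eqxx addNb.
rewrite (eq_bigr (tnth x)) // => k /negbTE ki; by rewrite tnth_flip ki.
Qed.

(** [S] holds the free directions. Any vertex of the subcube can serve as base, so a proof may
    choose which half it starts from. *)
Definition subcube S a : {set cube} := [set x | [forall k in ~: S, tnth x k == tnth a k]].

Lemma in_subcube S a x : reflect (forall k, k \notin S -> tnth x k = tnth a k) (x \in subcube S a).
Proof.
rewrite inE; apply: (iffP forall_inP) => H k kS; last by apply/eqP/H; rewrite inE in kS.
by apply/eqP/H; rewrite inE.
Qed.

Lemma mem_subcube S a : a \in subcube S a.
Proof. exact/in_subcube. Qed.

Lemma subcube_flip S a i x : i \in S -> (flip i x \in subcube S a) = (x \in subcube S a).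
Proof.
move=> iS; apply/in_subcube/in_subcube => H k kS; rewrite -H // tnth_flip;
  by case: eqP => // ki; rewrite -ki (negbTE kS) in iS.
Qed.

Lemma subcube_setT a : subcube [set: 'I_n] a = [set: cube].
Proof. by apply/setP => x; rewrite in_setT; apply/in_subcube => k; rewrite in_setT. Qed.

Lemma subcubeD1_subset S a i : subcube (S :\ i) a \subset subcube S a.
Proof.
apply/subsetP => x /in_subcube H; apply/in_subcube => k kS.
by rewrite H // !inE negb_and kS orbT.
Qed.

Lemma in_subcubeD1 S a i x : i \in S ->
  (x \in subcube (S :\ i) a) = (x \in subcube S a) && (tnth x i == tnth a i).
Proof.
move=> iS; apply/idP/andP => [xs | [/in_subcube H /eqP xi]].
  by rewrite (subsetP (subcubeD1_subset _ _ _) _ xs) (in_subcube _ _ _ xs) // !inE eqxx.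
by apply/in_subcube => k; rewrite !inE negb_and negbK => /orP[/eqP ->|/H].
Qed.

Lemma in_subcubeD1_flip S a i x : i \in S ->
  (x \in subcube (S :\ i) (flip i a)) = (x \in subcube S a) && (tnth x i != tnth a i).
Proof.
move=> iS; rewrite in_subcubeD1 // tnth_flip eqxx.
have -> : (x \in subcube S (flip i a)) = (x \in subcube S a).
  apply/in_subcube/in_subcube => H k kS; rewrite H // tnth_flip;
  by case: eqP => // ki; rewrite -ki (negbTE kS) in iS.
by case: (tnth x i); case: (tnth a i).
Qed.

Lemma subcube_flip_base S a i : i \in S -> subcube S (flip i a) = subcube S a.
Proof.
move=> iS; apply/setP => x.
by apply/in_subcube/in_subcube => H k kS; rewrite H // tnth_flip;
  case: eqP => // ki; rewrite -ki (negbTE kS) in iS.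
Qed.

Lemma card_subcube_split S a i X : i \in S ->
  #|X :&: subcube S a| = #|X :&: subcube (S :\ i) a| + #|X :&: subcube (S :\ i) (flip i a)|.
Proof.
move=> iS; rewrite -(cardsID [set x | tnth x i == tnth a i] (X :&: subcube S a)).
congr (_ + _); apply: eq_card => x.
  rewrite in_setI in_setI in_setI in_subcubeD1 // -andbA.
  by congr [&& _, _ & _]; rewrite in_set.
rewrite in_setD in_setI in_setI in_subcubeD1_flip // [RHS]andbA andbC.
by congr (_ && _); rewrite in_set.
Qed.

Lemma card_subcube S a : #|subcube S a| = 2 ^ #|S|.
Proof.
move: {2}#|S| (erefl #|S|) => d; elim: d S a => [|d IH] S a cS.
  rewrite cS; apply/eqP/cards1P; exists a; apply/setP => x; rewrite in_set1.
  apply/in_subcube/eqP => [H|->] //; apply: eq_from_tnth => k; apply: H.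
  by move/eqP: cS; rewrite cards_eq0 => /eqP ->; rewrite inE.
have [i iS] : exists i, i \in S by apply/card_gt0P; rewrite cS.
have cSi : #|S :\ i| = d by move: cS; rewrite (cardsD1 i) iS => -[].
have := card_subcube_split a setT iS.
by rewrite !setTI !(IH _ _ cSi) cSi => ->; rewrite cS expnS mul2n addnn.
Qed.

(** * Connectedness of a subcube after the deletion of few vertices *)

Definition locally_constant (c : cube -> bool) (V : {set cube}) :=
  {in V &, forall x y, cube_adj x y -> c x = c y}.

(* [P u] says that [c u] differs from the value of [c] on the connected half. *)
Lemma bad_half S a i X c : i \in S ->
  connected_on (@cube_adj n) (subcube (S :\ i) a :\: X) ->
  locally_constant c (subcube S a :\: X) ->
  ~ {in subcube S a :\: X &, forall x y, c x = c y} ->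
  exists v (P : pred cube), P v /\ forall u, P u ->
    [/\ u \in subcube (S :\ i) (flip i a), u \notin X, flip i u \in X
      & forall l, l \in S :\ i -> P (flip l u) \/ flip l u \in X].
Proof.
move=> iS conA lc nc.
have sA : {subset subcube (S :\ i) a :\: X <= subcube S a :\: X}.
  move=> x; rewrite !in_setD => /andP[->]; exact: (subsetP (subcubeD1_subset _ _ _)).
(* [b] is the colour of the connected half, and arbitrary if that half is wholly removed. *)
have [b bA] : exists b, {in subcube (S :\ i) a :\: X, forall x, c x = b}.
  have [A0 | [x xA]] := set_0Vmem (subcube (S :\ i) a :\: X).
    by exists true => x; rewrite A0 inE.
  exists (c x) => y yA; apply: (conA c) => // u v uA vA; apply: lc; exact: sA.
pose P := [pred u | [&& u \in subcube (S :\ i) (flip i a), u \notin X & c u != b]].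
have [v Pv] : exists v, P v.
  have [v|noP] := pickP P; first by exists v.
  case: nc; suff H : {in subcube S a :\: X, forall x, c x = b} by move=> x y /H -> /H ->.
  move=> x xS; have [xi | xi] := boolP (tnth x i == tnth a i).
    apply: bA; move: xS; rewrite !in_setD in_subcubeD1 // => /andP[-> ->] //.
  move: xS; rewrite in_setD => /andP[xX xS].
  by have /= := noP x; rewrite in_subcubeD1_flip // xS xi xX /= => /negbFE/eqP.
exists v, P; split=> // u /and3P[uS uX cu].
have uSX : u \in subcube S a :\: X.
  by move: uS; rewrite in_subcubeD1_flip // in_setD uX => /andP[].
split=> // [|l lS].
  (* A surviving partner of [u] would have colour [b] and pass it to [u] along direction [i]. *)
  apply: contraR cu => fX; have fA : flip i u \in subcube (S :\ i) a :\: X.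
    rewrite in_setD fX; move: uS; rewrite in_subcubeD1_flip // in_subcubeD1 // subcube_flip //=.
    by rewrite tnth_flip eqxx => /andP[-> ]; case: (tnth u i); case: (tnth a i).
  by rewrite -(bA _ fA) (lc _ (flip i u)) // ?sA // cube_adj_flip.
have [|fX] := boolP (flip l u \in X); [by right | left].
have lS' : l \in S by move: lS; rewrite !inE => /andP[].
rewrite /P /= subcube_flip // uS fX /=.
rewrite -(lc u) ?cube_adj_flip // in_setD fX subcube_flip //.
by move: uSX; rewrite in_setD => /andP[].
Qed.

(* Projecting along [i] maps [X] onto a superset of [W]. *)
Lemma column_count S a i X (W : {set cube}) v : i \in S ->
  W \subset subcube S a ->
  {in W, forall u, tnth u i = tnth v i} ->
  {in W, forall u, (u \in X) || (flip i u \in X)} ->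
  #|W| <= #|X :&: subcube S a|.
Proof.
move=> iS WS Wi WX.
pose proj x := if tnth x i == tnth v i then x else flip i x.
apply: leq_trans (leq_imset_card proj _); apply: subset_leq_card.
apply/subsetP => u uW; apply/imsetP.
have uS := subsetP WS _ uW.
have [uX | uX] := boolP (u \in X).
  by exists u; rewrite ?in_setI ?uX // /proj Wi // eqxx.
exists (flip i u); last by rewrite /proj tnth_flip eqxx Wi // flipK; case: (tnth v i).
by rewrite in_setI subcube_flip // uS andbT; move: (WX u uW); rewrite (negbTE uX).
Qed.

Definition star R v : {set cube} := v |: [set flip l v | l in R].

Lemma card_star R v : #|star R v| = #|R|.+1.
Proof.
rewrite /star cardsU1 card_imset; last exact: flip_injl.
case: imsetP => // -[l _ /eqP]; by rewrite eq_sym flip_neq.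
Qed.

Lemma star_tnth R v i u : i \notin R -> u \in star R v -> tnth u i = tnth v i.
Proof.
move=> iR; rewrite !inE => /orP[/eqP -> // | /imsetP[l lR ->]].
by rewrite tnth_flip; case: eqP => // il; rewrite il lR in iR.
Qed.

Lemma star_subset R S a v : R \subset S -> v \in subcube S a -> star R v \subset subcube S a.
Proof.
move=> RS vS; apply/subsetP => u; rewrite in_setU1 => /orP[/eqP -> // | /imsetP[l lR ->]].
by rewrite subcube_flip // (subsetP RS).
Qed.

(** Induction on the dimension: some half satisfies the hypothesis again and is connected. A bad
    vertex of the other half has a star meeting [#|S|] columns in direction [i], each with a removed
    vertex, which is one too many. *)
Lemma connected_few S a X : #|X :&: subcube S a| <= #|S|.-1 ->
  connected_on (@cube_adj n) (subcube S a :\: X).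
Proof.
move: {2}#|S| (erefl #|S|) => d; elim: d S a => [|d IH] S a cS hX c lc.
  have /cards1P[z zE] : #|subcube S a| == 1 by rewrite card_subcube cS.
  by move=> x y; rewrite zE !inE => /andP[_ /eqP ->] /andP[_ /eqP ->].
have [i iS] : exists i, i \in S by apply/card_gt0P; rewrite cS.
have cSi : #|S :\ i| = d by move: cS; rewrite (cardsD1 i) iS => -[].
(* If the half of [a] loses too many vertices, the opposite half loses few; flipping the base along
   [i] exchanges the halves. *)
have [b [sb hb]] : exists b, subcube S b = subcube S a /\ #|X :&: subcube (S :\ i) b| <= d.-1.
  have := card_subcube_split a X iS; rewrite cS /= in hX => e.
  have [le|gt] := leqP #|X :&: subcube (S :\ i) a| d.-1; first by exists a.
  exists (flip i a); rewrite subcube_flip_base //; split=> //.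
  by move: hX gt; rewrite e; move: #|_| #|_| => A B; clear; lia.
rewrite -sb in lc hX *.
have con := IH _ b cSi; rewrite cSi in con; move/con: hb => {}con.
move=> x y xs ys; apply/eqP/negPn/negP => cxy.
have nc : ~ {in subcube S b :\: X &, forall x y, c x = c y}.
  by move=> nc; rewrite (nc x y) ?eqxx in cxy.
have [v [P [Pv HP]]] := bad_half iS con lc nc.
have [vS vX fvX Hl] := HP v Pv.
have : #|star (S :\ i) v| <= #|X :&: subcube S b|.
  apply: (@column_count _ _ i _ _ v) => //.
  - apply: star_subset; first exact: subD1set.
    by move: vS; rewrite in_subcubeD1_flip // => /andP[].
  - by move=> u; apply: star_tnth; rewrite !inE eqxx.
  move=> u; rewrite !inE => /orP[/eqP -> | /imsetP[l lS ->]]; first by rewrite fvX orbT.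
  by case: (Hl l lS) => [/HP[_ _ -> _]|->]; rewrite ?orbT.
by move/leq_trans/(_ hX); rewrite card_star cSi cS ltnn.
Qed.

(** For [j] outside [R], this is the closed neighbourhood of the edge from [v] to [flip j v], in the
    directions of [R] and [j]. *)
Definition edge_star R j v : {set cube} := star R v :|: star R (flip j v).

Lemma card_edge_star R j v : j \notin R -> #|edge_star R j v| = 2 * #|R|.+1.
Proof.
move=> jR; rewrite /edge_star cardsU !card_star.
rewrite (_ : _ :&: _ = set0) ?cards0 ?subn0 ?addnn ?mul2n //.
apply/eqP; rewrite -subset0; apply/subsetP => u; rewrite in_setI => /andP[uv uw].
have := star_tnth jR uw; rewrite (star_tnth jR uv) tnth_flip eqxx.
by case: (tnth v j).
Qed.

Lemma edge_star_tnth R j v i u : i \notin R -> i != j -> u \in edge_star R j v ->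
  tnth u i = tnth v i.
Proof.
move=> iR ij; rewrite in_setU => /orP[] /(star_tnth iR) -> //.
by rewrite tnth_flip (negbTE ij).
Qed.

(** Apart from [j], a vertex of the edge star differs from [v] in at most one coordinate. *)
Lemma edge_star_tnth2 R j v s t u : s != t -> s != j -> t != j ->
  u \in edge_star R j v -> tnth u s = tnth v s \/ tnth u t = tnth v t.
Proof.
move=> st sj tj; rewrite in_setU.
have H w : u \in star R w -> tnth u s = tnth w s \/ tnth u t = tnth w t.
  rewrite in_setU1 => /orP[/eqP ->|/imsetP[l _ ->]]; first by left.
  rewrite !tnth_flip; case: eqP => [<-|]; last by left.
  by right; rewrite eq_sym (negbTE st).
by case/orP => /H; rewrite // !tnth_flip (negbTE sj) (negbTE tj).
Qed.

Definition covered i X u := (u \in X) || (flip i u \in X).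

Definition no_isolated S a X :=
  forall v, v \in subcube S a -> v \notin X -> exists2 l, l \in S & flip l v \notin X.

(** A bad vertex [v] is not isolated, and its surviving neighbour [flip j v] is bad too, with
    [j != i] since the partner of [v] is removed. Neighbours of bad vertices inside the half are bad
    or removed, so every column over the edge star is hit. The last clause goes one step further
    out, for the sharper count. *)
Lemma bad_edge S a i X c : i \in S ->
  connected_on (@cube_adj n) (subcube (S :\ i) a :\: X) ->
  no_isolated S a X ->
  locally_constant c (subcube S a :\: X) ->
  ~ {in subcube S a :\: X &, forall x y, c x = c y} ->
  exists v j (W := edge_star (S :\ i :\ j) j v),
    [/\ v \in subcube S a, j \in S :\ i, v \notin X, flip i v \in X &
    [/\ #|W| = 2 * #|S|.-1, W \subset subcube S a, {in W, forall u, tnth u i = tnth v i},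
       {in W, forall u, covered i X u} &
       forall u l, u \in W -> u \notin X -> l \in S :\ i -> covered i X (flip l u)]].
Proof.
move=> iS con iso lc nc.
have [v [P [Pv HP]]] := bad_half iS con lc nc.
have [vS vX fvX Hl] := HP v Pv.
have vSa : v \in subcube S a by move: vS; rewrite in_subcubeD1_flip // => /andP[].
have [j jS fjX] := iso v vSa vX.
have jSi : j \in S :\ i by rewrite !inE jS andbT; apply: contraNneq fjX => ->.
have Pw : P (flip j v) by case: (Hl j jSi) => // wX; rewrite wX in fjX.
have ij : i != j by move: jSi; rewrite !inE eq_sym => /andP[].
have cP u : P u -> covered i X u by case/HP => _ _ uX _; rewrite /covered uX orbT.
have cl u l : P u -> l \in S :\ i -> P (flip l u) \/ flip l u \in X.
  by case/HP => _ _ _; apply.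
have WP u : u \in edge_star (S :\ i :\ j) j v -> P u \/ u \in X.
  by rewrite in_setU !in_setU1 => /orP[] /orP[/eqP -> | /imsetP[l lS ->]];
    (by left) || (apply: cl => //; apply: (subsetP (subD1set _ j))).
exists v, j; split=> //; split.
- rewrite card_edge_star ?inE ?eqxx // (cardsD1 i S) iS (cardsD1 j (S :\ i)) jSi.
  by [].
- have sS : S :\ i :\ j \subset S by rewrite (subset_trans (subD1set _ _)) ?subD1set.
  by rewrite subUset !star_subset // subcube_flip.
- by move=> u; apply: edge_star_tnth; rewrite // !inE eqxx andbF.
- by move=> u /WP[/cP // | uX]; rewrite /covered uX.
move=> u l /WP[Pu _ lS | -> //].
by case: (cl u l Pu lS) => [/cP // | flX]; rewrite /covered flX.
Qed.

(** One half loses at most [#|S| - 2] vertices and is connected by [connected_few]; a bad edge in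
    the other half would force [2 * (#|S| - 1)] removed vertices. *)
Lemma connected_no_isolated S a X : #|X :&: subcube S a| + 3 <= 2 * #|S| ->
  no_isolated S a X -> connected_on (@cube_adj n) (subcube S a :\: X).
Proof.
move=> hX iso c lc.
have [i iS] : exists i, i \in S.
  by apply/card_gt0P; move: hX; move: #|_| #|_| => A B; clear; lia.
have cSi : #|S| = #|S :\ i|.+1 by rewrite (cardsD1 i) iS.
have [b [sb hb]] : exists b, subcube S b = subcube S a /\ #|X :&: subcube (S :\ i) b| <= #|S :\ i|.-1.
  have e := card_subcube_split a X iS.
  have [le|gt] := leqP #|X :&: subcube (S :\ i) a| #|S :\ i|.-1; first by exists a.
  exists (flip i a); rewrite subcube_flip_base //; split=> //.
  by move: hX gt; rewrite e cSi; move: #|_| #|_| #|_| => A B C; clear; lia.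
have con := connected_few hb.
have iso' : no_isolated S b X by move=> v; rewrite sb; apply: iso.
rewrite -sb in lc hX *.
move=> x y xs ys; apply/eqP/negPn/negP => cxy.
have nc : ~ {in subcube S b :\: X &, forall x y, c x = c y}.
  by move=> nc; rewrite (nc x y) ?eqxx in cxy.
have [v [j [_ _ _ _ [cW WS Wi Wc _]]]] := bad_edge iS con iso' lc nc.
have := column_count iS WS Wi Wc; rewrite cW.
by move: hX; move: #|_| #|_| => A B; clear; lia.
Qed.

(* The bound is one more than the previous lemma allows, and it is attained by
   the neighbourhood of an edge; the last hypothesis excludes this set. *)
Lemma connected_two_neighbours S a X : 4 <= #|S| -> #|X :&: subcube S a| + 2 <= 2 * #|S| ->
  no_isolated S a X ->
  (forall x, x \in X -> x \in subcube S a ->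
     exists p q, [/\ p \in S, q \in S, p != q, flip p x \in X & flip q x \in X]) ->
  connected_on (@cube_adj n) (subcube S a :\: X).
Proof.
move=> S4 hX iso two.
have [X0 | [x]] := set_0Vmem (X :&: subcube S a).
  by apply: connected_few; rewrite X0 cards0.
rewrite in_setI => /andP[xX xS].
(* The second direction serves to split the cube, so the removed vertices [x] and [flip p x] lie in
   the same half. *)
have [p [i [pS iS pi fpX _]]] := two x xX xS.
have cSi : #|S| = #|S :\ i|.+1 by rewrite (cardsD1 i) iS.
have sx : subcube S x = subcube S a.
  apply/setP => y; have/in_subcube H := xS.
  by apply/in_subcube/in_subcube => H' k kS; rewrite H' // H.
have [b [sb con]] : exists b, subcube S b = subcube S a /\
    connected_on (@cube_adj n) (subcube (S :\ i) b :\: X).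
  have e := card_subcube_split x X iS; rewrite sx in e.
  have [le|gt] := leqP #|X :&: subcube (S :\ i) x| #|S :\ i|; last first.
    exists (flip i x); rewrite subcube_flip_base //; split=> //; apply: connected_few.
    by move: hX gt; rewrite e cSi; move: #|_| #|_| #|_| => A B C; clear; lia.
  exists x; split=> //; apply: connected_no_isolated.
    by move: le S4; rewrite cSi; move: #|_| #|_| => A B; clear; lia.
  move=> v vS vX; apply/exists_inP; apply: contraT; rewrite negb_exists_in => /forall_inP H.
  (* The neighbours of an isolated [v] would be all the removed vertices of this half and share one
     parity, but [x] and [flip p x] have opposite parities. *)
  have NX : [set flip l v | l in S :\ i] = X :&: subcube (S :\ i) x.
    apply/eqP; rewrite eqEcard card_imset ?le; last exact: flip_injl.
    rewrite andbT; apply/subsetP => _ /imsetP[l lS ->].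
    by rewrite in_setI subcube_flip // vS andbT; have := H l lS; rewrite negbK.
  have pSi : p \in S :\ i by rewrite !inE pi.
  have : x \in X :&: subcube (S :\ i) x by rewrite in_setI xX mem_subcube.
  have : flip p x \in X :&: subcube (S :\ i) x by rewrite in_setI fpX subcube_flip ?mem_subcube.
  rewrite -NX => /imsetP[l _ E] /imsetP[l' _ E'].
  have := congr1 parity E; rewrite E' !parity_flip.
  by case: (parity v).
have iso' : no_isolated S b X by move=> v; rewrite sb; apply: iso.
rewrite -sb in two hX *.
move=> c lc y z ys zs; apply/eqP/negPn/negP => cyz.
have nc : ~ {in subcube S b :\: X &, forall x y, c x = c y}.
  by move=> nc; rewrite (nc y z) ?eqxx in cyz.
have [v [j [vS jS vX fvX [cW WS Wi Wc Wn]]]] := bad_edge iS con iso' lc nc.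
(* The removed partner of [v] has two removed neighbours, neither of them [v], and at least one lies
   off direction [j]. *)
have [s [sS si sj fsX]] : exists s, [/\ s \in S, s != i, s != j & flip i (flip s v) \in X].
  have [|p' [q' [p'S q'S pq fp fq]]] := two _ fvX; first by rewrite subcube_flip.
  have ni r : flip r (flip i v) \in X -> r != i.
    by apply: contraTneq => ->; rewrite flipK.
  have [pj|pj] := eqVneq p' j.
    by exists q'; rewrite -pj (eq_sym q' p') flipC; split=> //; exact: ni.
  by exists p'; rewrite flipC; split=> //; exact: ni.
have sR : s \in S :\ i :\ j by rewrite !inE sj si.
set W := edge_star _ _ _ in cW WS Wi Wc Wn.
have uW : flip s v \in W.
  by rewrite in_setU in_setU1 (imset_f (flip^~ v) sR) orbT.
(* If [flip s v] is removed as well, its column contains two removed vertices; dropping one still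
   leaves every column of [W] hit. *)
have [uX|uX] := boolP (flip s v \in X).
  have : #|W| <= #|(X :\ flip i (flip s v)) :&: subcube S b|.
    apply: (column_count iS WS Wi) => u' u'W.
    have [/eqP Eu|ne] := boolP (flip i u' == flip i (flip s v)).
      have -> : u' = flip s v by rewrite -(flipK i u') Eu flipK.
      by rewrite in_setD1 uX eq_sym flip_neq.
    rewrite !in_setD1 ne; case/orP: (Wc _ u'W) => ->; rewrite ?orbT // andbT.
    apply/orP; left; apply/eqP => E; have := Wi _ u'W; rewrite E tnth_flip eqxx.
    by rewrite (Wi _ uW); case: (tnth v i).
  have lt : #|(X :\ flip i (flip s v)) :&: subcube S b| < #|X :&: subcube S b|.
    rewrite [X in _ < X](cardsD1 (flip i (flip s v))) in_setI fsX !subcube_flip //.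
    by rewrite vS setIDAC.
  rewrite cW => le; move: (leq_ltn_trans le lt) hX.
  by move: #|_| #|_| => A B; clear; lia.
(* Otherwise [flip s v] survives, and the columns next to it are hit as well. A fourth direction [t]
   yields such a column outside [W]. *)
have [t] : exists t, t \in S :\ i :\ j :\ s.
  apply/card_gt0P; move: S4; rewrite cSi (cardsD1 j (S :\ i)) jS (cardsD1 s (S :\ i :\ j)) sR.
  by move: #|_| => A; clear; lia.
rewrite !inE => /and4P[ts tj ti tS].
have : #|flip t (flip s v) |: W| <= #|X :&: subcube S b|.
  apply: (column_count (v := v) iS).
  - by rewrite subUset sub1set WS !subcube_flip // vS.
  - move=> u; rewrite in_setU1 => /orP[/eqP -> | /Wi //].
    by rewrite !tnth_flip ![i == _]eq_sym (negbTE ti) (negbTE si).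
  move=> u; rewrite in_setU1 => /orP[/eqP -> | /Wc //].
  by apply: Wn => //; rewrite !inE ti.
rewrite cardsU1 cW (_ : _ \notin W).
  by move: hX; move: #|_| #|_| => A B; clear; lia.
apply/negP => /(edge_star_tnth2 ts tj sj); rewrite !tnth_flip !eqxx (negbTE ts).
by rewrite eq_sym (negbTE ts); case: (tnth v t); case: (tnth v s) => -[].
Qed.

(** * Deleting subcubes of dimension at most 2 *)

Definition subcubes (fs : seq ({set 'I_n} * cube)) : {set cube} :=
  [set x | has (fun f => x \in subcube f.1 f.2) fs].

Lemma in_subcubes fs x : (x \in subcubes fs) = has (fun f => x \in subcube f.1 f.2) fs.
Proof. by rewrite inE. Qed.

Definition meets (D : {set cube}) (f : {set 'I_n} * cube) := D :&: subcube f.1 f.2 != set0.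

Lemma meetsP D f : reflect (exists2 x, x \in D & x \in subcube f.1 f.2) (meets D f).
Proof.
apply: (iffP (set0Pn _)) => [[x] | [x xD xf]]; last by exists x; rewrite in_setI xD.
by rewrite in_setI => /andP[xD xf]; exists x.
Qed.

Lemma card_subcubes fs D : all (fun f : {set 'I_n} * cube => #|f.1| <= 2) fs ->
  #|subcubes fs :&: D| <= 4 * count (meets D) fs.
Proof.
elim: fs => [_|f fs IH /= /andP[f2 /IH le]].
  by rewrite leqn0 cards_eq0 -subset0; apply/subsetP => x; rewrite in_setI in_subcubes.
have -> : subcubes (f :: fs) :&: D = (D :&: subcube f.1 f.2) :|: (subcubes fs :&: D).
  apply/setP => x; rewrite in_setI in_subcubes /= in_setU in_setI [x \in _ :&: D]in_setI.
  by rewrite in_subcubes (andbC (x \in D)) -andb_orl.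
apply: leq_trans (leq_card_setU _ _) _; rewrite mulnDr leq_add //.
rewrite /meets; case: eqVneq => [-> | _]; first by rewrite cards0.
apply: leq_trans (subset_leq_card (subsetIr _ _)) _.
by rewrite card_subcube (leq_trans (leq_pexp2l _ f2)).
Qed.

Lemma connected_subcubes fs S a : all (fun f : {set 'I_n} * cube => #|f.1| <= 2) fs ->
  count (meets (subcube S a)) fs + 3 <= #|S| ->
  connected_on (@cube_adj n) (subcube S a :\: subcubes fs).
Proof.
move=> fs2; move: {2}(count _ _).+1 (ltnSn (count (meets (subcube S a)) fs)) => k.
elim: k S a => // k IH S a ck hS.
have [/hasP[f ffs /meetsP[z zD zf]] | nof] := boolP (has (meets (subcube S a)) fs); last first.
  apply: connected_few; rewrite (_ : _ :&: _ = set0) ?cards0 //.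
  apply/eqP; rewrite -subset0; apply/subsetP => x; rewrite in_setI in_subcubes => /andP[].
  case/hasP=> f ffs xf xD; case/hasP: nof; exists f => //; apply/meetsP.
  by exists x.
have f2 := allP fs2 f ffs.
(* As [f] has dimension at most 2, some direction of [S] is not spanned by [f], and [f] then lies in
   one half. *)
have [i iS fi] : exists2 i, i \in S & i \notin f.1.
  apply/subsetPn; apply: contraL hS => /subset_leq_card le.
  by rewrite -ltnNge (leq_ltn_trans (leq_trans le f2)) // addn3.
have cSi : #|S| = #|S :\ i|.+1 by rewrite (cardsD1 i) iS.
have sz : subcube S z = subcube S a.
  apply/setP => y; have/in_subcube H := zD.
  by apply/in_subcube/in_subcube => H' l lS; rewrite H' // H.
have half b g : b \in subcube S z -> g \in fs -> meets (subcube S z) g ->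
    ~~ meets (subcube (S :\ i) b) g ->
    connected_on (@cube_adj n) (subcube (S :\ i) b :\: subcubes fs).
  move=> bz gfs gz gb; suff lt : count (meets (subcube (S :\ i) b)) fs < count (meets (subcube S z)) fs.
    rewrite sz in lt; apply: IH; first exact: leq_trans lt _.
    by rewrite -ltnS -cSi (leq_trans _ hS) // ltn_add2r.
  apply: (count_lt _ gfs gz gb) => h /meetsP[x xb xh]; apply/meetsP; exists x => //.
  move/(subsetP (subcubeD1_subset _ _ _))/in_subcube: xb => xb.
  by apply/in_subcube => l lS; rewrite xb //; exact: (in_subcube _ _ _ bz).
have zz := mem_subcube S z; have fzz : flip i z \in subcube S z by rewrite subcube_flip.
have fm : meets (subcube S z) f by apply/meetsP; exists z.
have con1 : connected_on (@cube_adj n) (subcube (S :\ i) (flip i z) :\: subcubes fs).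
  apply: (half _ f _ ffs fm) => //; apply/meetsP => -[x].
  rewrite in_subcubeD1_flip // => /andP[_ /eqP xz] /in_subcube xf; apply: xz.
  by move/in_subcube: zf => zf; rewrite xf // zf.
rewrite -sz => c lc x y xs ys; apply/eqP/negPn/negP => cxy.
have nc : ~ {in subcube S z :\: subcubes fs &, forall x y, c x = c y}.
  by move=> nc; rewrite (nc x y) ?eqxx in cxy.
have sfz : subcube S (flip i z) = subcube S z by rewrite subcube_flip_base.
rewrite -sfz in lc nc.
have [v [P [Pv HP]]] := bad_half iS con1 lc nc.
have [vz vX fvX _] := HP v Pv; rewrite flipK in vz.
move: fvX; rewrite in_subcubes => /hasP[g gfs fvg].
have gm : meets (subcube S z) g.
  apply/meetsP; exists (flip i v) => //; rewrite subcube_flip //.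
  by rewrite in_subcubeD1 // in vz; case/andP: vz.
(* The subcube [g] removes the partner of [v] but not [v], so it does not span [i] and misses the
   half of [z]. *)
have con2 : connected_on (@cube_adj n) (subcube (S :\ i) z :\: subcubes fs).
  apply: (half _ g _ gfs gm) => //; apply/meetsP => -[w]; rewrite in_subcubeD1 // => /andP[_ /eqP wz] wg.
  case/negP: vX; rewrite in_subcubes; apply/hasP; exists g => //.
  have [gi|gi] := boolP (i \in g.1); first by rewrite -(subcube_flip _ _ gi).
  exfalso.
  move/in_subcube/(_ i gi): wg; move/in_subcube/(_ i gi): fvg => <-; rewrite tnth_flip eqxx wz.
  by rewrite in_subcubeD1 // in vz; case/andP: vz => _ /eqP ->; case: (tnth z i).
(* There are [2 ^ (#|S| - 1)] columns, while [t] subcubes remove at most [4 * t] vertices, and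
   [4 * t < 2 ^ t.+2]. *)
have [u uz uX] : exists2 u, u \in subcube (S :\ i) z & ~~ covered i (subcubes fs) u.
  apply/exists_inP; apply: contraT; rewrite negb_exists_in => /forall_inP Hc.
  have : #|subcube (S :\ i) z| <= #|subcubes fs :&: subcube S z|.
    apply: (column_count (v := z) iS); first exact: subcubeD1_subset.
      by move=> u; rewrite in_subcubeD1 // => /andP[_ /eqP].
    by move=> u /Hc; rewrite negbK.
  move/leq_trans/(_ (card_subcubes (subcube S z) fs2)); rewrite card_subcube leqNgt => /negP[].
  rewrite sz; set t := count _ _ in hS *.
  have le : 2 ^ t.+2 <= 2 ^ #|S :\ i|.
    by rewrite leq_exp2l // -ltnS -cSi (leq_trans _ hS) // addn3.
  by apply: leq_trans le; rewrite !expnS mulnA ltn_pmul2l // ltn_expl.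
rewrite /covered negb_or in uX; case/andP: uX => uX fuX.
have uS : u \in subcube S z by rewrite in_subcubeD1 // in uz; case/andP: uz.
have cu : c u = c (flip i u).
  by apply: lc; rewrite ?cube_adj_flip // sfz in_setD ?uX ?fuX ?subcube_flip.
have H w : w \in subcube S z :\: subcubes fs -> c w = c u.
  rewrite in_setD => /andP[wX wS]; have [wi|wi] := boolP (tnth w i == tnth z i).
    apply: con2; rewrite ?in_setD ?uX ?uz ?wX ?in_subcubeD1 ?wS //.
    move=> p q pz qz; apply: lc; rewrite sfz.
      by apply: (subsetP (setSD _ (subcubeD1_subset _ _ _))) pz.
    by apply: (subsetP (setSD _ (subcubeD1_subset _ _ _))) qz.
  rewrite cu; apply: con1.
  - move=> p q pz qz; apply: lc.
      by apply: (subsetP (setSD _ (subcubeD1_subset _ _ _))) pz.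
    by apply: (subsetP (setSD _ (subcubeD1_subset _ _ _))) qz.
  - by rewrite in_setD wX in_subcubeD1_flip // wS.
  rewrite in_setD fuX in_subcubeD1_flip // subcube_flip // uS tnth_flip eqxx.
  by move: uz; rewrite in_subcubeD1 // => /andP[_ /eqP ->]; case: (tnth z i).
by rewrite (H x) // (H y) // eqxx in cxy.
Qed.

End Cube.

(** * Cycle subgraphs as injective cyclic maps *)

Lemma sub_adj_adj (G : sgraph) (S : subgraph G) (x y : {z : G | z \in sub_verts S}) :
  sub_adj x y -> adj (val x) (val y).
Proof.
rewrite /sub_adj => xy; have /andP[/subsetP sE _] := valP S.
have /imsetP[[a b]] := sE _ xy; rewrite inE /= => ab E.
have xab : val x \in [set a; b] by rewrite -E set21.
have yab : val y \in [set a; b] by rewrite -E set22.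
have aE : a \in [set val x; val y] by rewrite E set21.
have bE : b \in [set val x; val y] by rewrite E set22.
case/set2P: xab => xE; case/set2P: yab => yE; rewrite xE yE //.
- by move: bE; rewrite xE yE setUid => /set1P ba; rewrite ba adj_irr in ab.
- by rewrite adj_sym.
by move: aE; rewrite xE yE setUid => /set1P ba; rewrite ba adj_irr in ab.
Qed.

Lemma ordS_neq k (i : 'I_k) : 2 <= k -> i != ordS i.
Proof.
move=> k2; apply/eqP => /(congr1 val) /= E.
have := ltn_ord i; rewrite leq_eqVlt => /orP[/eqP Ei|lt].
  by move: E; rewrite Ei modnn => i0; rewrite i0 in Ei; lia.
by move: E; rewrite modn_small // => /eqP; rewrite ltn_eqF.
Qed.

(** This separates the successor of a cycle vertex from its predecessor. *)
Lemma ordS2_neq k (i : 'I_k) : 3 <= k -> i != ordS (ordS i).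
Proof.
move=> k3; apply/eqP => /(congr1 val) /= E; have lik := ltn_ord i.
have [lt|ge] := ltnP i.+1 k; last first.
  have Ei : i.+1 = k by apply/eqP; rewrite eqn_leq lik ge.
  by move: E; rewrite Ei modnn modn_small; lia.
move: E; rewrite (modn_small lt); have [lt2|ge2] := ltnP i.+2 k.
  by rewrite modn_small //; lia.
have Ei : i.+2 = k by lia.
by rewrite Ei modnn; lia.
Qed.

Lemma cycle_param (G : sgraph) k (S : subgraph G) : 3 <= k ->
  isomorphic (graph_of_subgraph S) (cycle_graph k) ->
  exists g : 'I_k -> G, [/\ injective g, forall i, adj (g i) (g (ordS i)) &
    sub_verts S = [set g i | i : 'I_k]].
Proof.
move=> k3 [f [[h fK hK] fadj]].
exists (fun i => val (h i)); split.
- by move=> i j /val_inj; exact: (can_inj hK).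
- move=> i; apply: sub_adj_adj; rewrite -[sub_adj _ _]fadj !hK /= /cycle_adj eqxx.
  by rewrite ordS_neq // ltnW.
apply/setP => z; apply/idP/imsetP => [zS|[i _ ->]]; last exact: valP.
by exists (f (Sub z zS)); rewrite // fK.
Qed.

(** The edges are exactly the pairs of successive vertices, so chords present in [G] do not spoil
    the isomorphism. *)
Lemma cycle_subgraph (G : sgraph) k (g : 'I_k -> G) : 3 <= k -> injective g ->
  (forall i, adj (g i) (g (ordS i))) ->
  exists S : subgraph G, isomorphic (graph_of_subgraph S) (cycle_graph k) /\
    sub_verts S = [set g i | i : 'I_k].
Proof.
move=> k3 injg adjg.
pose V := [set g i | i : 'I_k]; pose E := [set [set g i; g (ordS i)] | i : 'I_k].
have isS : is_subgraph (V, E).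
  apply/andP; split => /=.
    apply/subsetP => _ /imsetP[i _ ->]; apply/imsetP.
    by exists (g i, g (ordS i)); rewrite // inE /=.
  apply/bigcupsP => _ /imsetP[i _ ->]; apply/subsetP => z.
  by rewrite !inE => /orP[] /eqP ->; apply: imset_f.
pose S : subgraph G := Sub (V, E) isS; exists S; split=> //.
have gV i : g i \in sub_verts S by apply: imset_f.
pose h i : {z : G | z \in sub_verts S} := Sub (g i) (gV i).
have ex (z : {z : G | z \in sub_verts S}) : exists i, h i == z.
  by have /imsetP[i _ E'] := valP z; exists i; apply/eqP/val_inj; rewrite E'.
pose f z := xchoose (ex z).
have fK : cancel f h by move=> z; apply/eqP/(xchooseP (ex z)).
have injh : injective h by move=> i j /(congr1 val) /injg.
have hK : cancel h f by move=> i; apply: injh; rewrite fK.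
exists f; split; first by exists h.
move=> x y; rewrite -[x in RHS]fK -[y in RHS]fK; move: (f x) (f y) => i j.
rewrite /= /cycle_adj /sub_adj /=; apply/andP/imsetP => [[_ /orP[] /eqP <-]|].
- by exists i.
- by exists j; rewrite // setUC.
case=> l _ E'.
have iM : g i \in [set g l; g (ordS l)] by rewrite -E' set21.
have jM : g j \in [set g l; g (ordS l)] by rewrite -E' set22.
have lM : g l \in [set g i; g j] by rewrite E' set21.
have slM : g (ordS l) \in [set g i; g j] by rewrite E' set22.
have nl := ordS_neq l (ltnW k3).
case/set2P: iM => /injg iE; case/set2P: jM => /injg jE; rewrite iE jE.
- by move: slM; rewrite iE jE setUid => /set1P/injg/eqP; rewrite eq_sym (negbTE nl).
- by rewrite nl eqxx.
- by rewrite eq_sym nl eqxx orbT.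
by move: lM; rewrite iE jE setUid => /set1P/injg/eqP; rewrite (negbTE nl).
Qed.

(** * Lower bound for cycles of length [2 * q] *)

Section HypercubeCut.
Variable n : nat.
Local Notation cube := (n.-tuple bool).

Lemma card_cube : #|{: cube}| = 2 ^ n.
Proof. by rewrite card_tuple card_bool. Qed.

(** The cardinality hypothesis leaves at least two vertices, which rules out a trivial remainder. *)
Lemma not_cut (H : sgraph) (F : {set subgraph (hypercube n)}) :
  connected_on (@cube_adj n) (~: family_verts F) ->
  #|family_verts F|.+1 < 2 ^ n -> ~ structure_cut H F.
Proof.
move=> con lt [_ [dis|triv]]; first exact: (@connected_on_induced (hypercube n) _ con dis).
have := cardsC (family_verts F); rewrite card_cube.
move: triv; rewrite /trivial_graph /remove_family /= card_sig => E E'.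
have E2 : #|~: family_verts F| = 1 by rewrite -E; apply: eq_card => z.
by rewrite E2 addn1 in E'; rewrite E' ltnn in lt.
Qed.

Lemma card_family_verts (F : {set subgraph (hypercube n)}) (p : pred cube) q :
  (forall S, S \in F -> #|[set x in sub_verts S | p x]| <= q) ->
  #|[set x in family_verts F | p x]| <= #|F| * q.
Proof.
move=> Fq; rewrite -sum_nat_const.
have -> : [set x in family_verts F | p x] = \bigcup_(S in F) [set x in sub_verts S | p x].
  apply/setP => x; rewrite inE; apply/andP/bigcupP => [[/bigcupP[S SF xS] px]|[S SF]].
    by exists S; rewrite // inE xS.
  by rewrite inE => /andP[xS ->]; split=> //; apply/bigcupP; exists S.
apply: (@leq_trans (\sum_(S in F) #|[set x in sub_verts S | p x]|)); last exact: leq_sum.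
apply: (big_rec2 (fun (A : {set cube}) s => #|A| <= s)); first by rewrite cards0.
move=> S s A _ le; apply: leq_trans (leq_card_setU _ _) _; exact: leq_add.
Qed.

(** Each step along the cycle changes the parity, so the successor map injects either parity class
    into the other. *)
Lemma balanced_cycle q (g : 'I_(2 * q) -> cube) b : injective g ->
  (forall i, cube_adj (g i) (g (ordS i))) ->
  #|[set x in [set g i | i : 'I_(2 * q)] | parity x == b]| <= q.
Proof.
move=> injg adjg; pose A b := [set i | parity (g i) == b].
have -> : [set x in [set g i | i : 'I_(2 * q)] | parity x == b] = g @: A b.
  apply/setP => x; rewrite inE; apply/andP/imsetP => [[/imsetP[i _ ->] pb]|[i]].
    by exists i; rewrite // inE.
  by rewrite inE => pb ->; split=> //; apply: imset_f.
rewrite card_imset //.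
have le b' : #|A b'| <= #|A (~~ b')|.
  rewrite -(card_imset _ (@ordS_inj _)); apply: subset_leq_card.
  apply/subsetP => _ /imsetP[i + ->]; rewrite !inE => /eqP <-.
  by have /cube_adjP[l ->] := adjg i; rewrite parity_flip.
have E : #|A b| + #|A (~~ b)| = 2 * q.
  rewrite -[RHS](card_ord (2 * q)) -(cardsC (A b)); congr (_ + _); apply: eq_card => i.
  by rewrite !inE; case: (parity (g i)); case: b.
by have := le b; rewrite -(leq_add2l #|A b|) E addnn -mul2n leq_pmul2l.
Qed.

Lemma cycle_cut_lower q (F : {set subgraph (hypercube n)}) : 4 <= n -> 2 <= q ->
  structure_cut (cycle_graph (2 * q)) F -> n <= #|F| * q.
Proof.
move=> n4 q2 cut; rewrite leqNgt; apply/negP => lt.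
have k3 : 3 <= 2 * q by lia.
have par S : S \in F -> exists g : 'I_(2 * q) -> cube,
    [/\ injective g, forall i, cube_adj (g i) (g (ordS i)) &
    sub_verts S = [set g i | i : 'I_(2 * q)]].
  by move=> SF; have [g [? ? ?]] := cycle_param k3 (cut.1 S SF); exists g.
set X : {set cube} := family_verts F.
have hp b : #|[set x in X | parity x == b]| <= n.-1.
  apply: (@leq_trans (#|F| * q)); last by lia.
  by apply: card_family_verts => S /par[g [injg adjg ->]]; exact: balanced_cycle.
(* Adding the two parity classes gives exactly the bound that [connected_two_neighbours]
   tolerates. *)
have cX : #|X| <= 2 * n.-1.
  rewrite -(cardsID [set x | parity x == true]) mul2n -addnn.
  apply: leq_add; [apply: leq_trans (hp true) | apply: leq_trans (hp false)];
    apply: subset_leq_card; apply/subsetP => x; rewrite !inE; first by [].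
  by case: (parity x); rewrite ?andbF //= andbT.
apply: (not_cut _ _ cut); last first.
  rewrite -/X; have : 2 * n.-1 + 2 <= 2 ^ n.
    by case: n n4 => // d _; rewrite expnS /= -mulnSr leq_pmul2l // ltn_expl.
  by apply: leq_trans; rewrite addn2 !ltnS.
pose a : cube := [tuple false | i < n].
rewrite -/X (_ : ~: X = subcube setT a :\: X); last by rewrite subcube_setT setTD.
apply: connected_two_neighbours; rewrite ?cardsT ?card_ord ?subcube_setT ?setIT //.
- by lia.
(* All [n] neighbours of [v] have the same parity, and at most [n - 1] vertices of that parity are
   removed. *)
- move=> v _ vX; apply/exists_inP; apply: contraT; rewrite negb_exists_in => /forall_inP Hl.
  have : #|[set flip l v | l in setT]| <= n.-1.
    apply: leq_trans (hp (~~ parity v)); apply: subset_leq_card.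
    apply/subsetP => _ /imsetP[l _ ->]; rewrite inE parity_flip eqxx andbT.
    by have := Hl l (in_setT _); rewrite negbK.
  by rewrite card_imset ?cardsT ?card_ord; [lia | exact: flip_injl].
move=> x /bigcupP[S SF xS] _; have [g [injg adjg E]] := par S SF.
have gX i : g i \in X by apply/bigcupP; exists S; rewrite // E imset_f.
move: xS; rewrite E => /imsetP[i _ ->].
(* The two removed neighbours are the successor and the predecessor on the cycle. *)
have /cube_adjP[p Ep] := adjg i.
have := adjg (ord_pred i); rewrite ord_predK cube_adj_sym => /cube_adjP[r Er].
exists p, r; rewrite !in_setT -Ep -Er !gX; split=> //.
apply/eqP => pr; have : ordS i = ord_pred i by apply: injg; rewrite Ep Er pr.
move/(congr1 (@ordS _)); rewrite ord_predK => /esym/eqP.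
by rewrite (negbTE (ordS2_neq _ k3)).
Qed.

End HypercubeCut.

(** * Cycles given by lists of vertices *)

Lemma cycle_subgraph_seq (G : sgraph) (c : seq G) : 3 <= size c -> uniq c ->
  cycle (@adj G) c ->
  exists S : subgraph G, isomorphic (graph_of_subgraph S) (cycle_graph (size c)) /\
    sub_verts S =i c.
Proof.
case: c => // x0 p; set c := x0 :: p => c3 uc cc.
pose g (i : 'I_(size c)) := nth x0 c i.
have adjg i : adj (g i) (g (ordS i)).
  have gc : g i \in c by apply: mem_nth.
  have := next_cycle cc gc; rewrite next_nth gc index_uniq //=.
  suff -> : nth x0 p i = g (ordS i) by [].
  rewrite /g /=; have := ltn_ord i; rewrite leq_eqVlt => /orP[/eqP E|lt].
    (* At the last index [nth] runs past [p] and returns its default [x0], which is the head of the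
       cycle. *)
    by rewrite E modnn /= nth_default // -ltnS [X in _ < X]E.
  by rewrite modn_small.
have injg : injective g by move=> i j /eqP; rewrite nth_uniq // => /eqP /val_inj.
have [S [iso SV]] := cycle_subgraph c3 injg adjg.
exists S; split=> // x; rewrite SV; apply/imsetP/idP => [[i _ ->]|]; first exact: mem_nth.
by move=> /(nthP x0)[i ic <-]; exists (Ordinal ic).
Qed.

Lemma cycle_mkseq (T : eqType) (e : rel T) (f : nat -> T) N :
  (forall k, k < N -> e (f k) (f (k.+1 %% N))) -> cycle e (mkseq f N).
Proof.
case: N => // N ef; have E : mkseq f N.+1 = f 0 :: mkseq (f \o succn) N.
  by rewrite /mkseq /= -[1]/(1 + 0) iotaDl -map_comp.
rewrite E /=; apply/(pathP (f 0)) => i; rewrite size_rcons size_mkseq => iN.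
have -> : nth (f 0) (f 0 :: rcons (mkseq (f \o succn) N) (f 0)) i = f i.
  by rewrite -rcons_cons -E nth_rcons size_mkseq iN nth_mkseq.
rewrite nth_rcons size_mkseq; move: (ef i iN).
move: iN; rewrite ltnS leq_eqVlt => /orP[/eqP -> | lt]; first by rewrite modnn ltnn eqxx.
by rewrite modn_small // lt nth_mkseq.
Qed.

Lemma modn_succ a r : a < r -> a.+1 %% r = if a.+1 == r then 0 else a.+1.
Proof.
rewrite leq_eqVlt => /orP[/eqP -> | lt]; first by rewrite modnn eqxx.
by rewrite modn_small // ltn_eqF.
Qed.

(** * Cycles of length 4 and the value [n - 2] *)

Section HypercubeCycles.
Variable n : nat.
Local Notation cube := (n.-tuple bool).
Implicit Types (x a : cube) (i j : 'I_n).

(** The list follows the cyclic order of the square, so it can serve as a 4-cycle. *)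
Lemma subcube_pair i j a x : i != j ->
  (x \in subcube [set i; j] a) = (x \in [:: a; flip i a; flip j (flip i a); flip j a]).
Proof.
move=> ij; have si := set21 i j; have sj := set22 i j.
apply/idP/idP => [/in_subcube H|]; last first.
  by rewrite !in_cons in_nil orbF => /or4P[] /eqP ->; rewrite !(subcube_flip, mem_subcube).
have E y : tnth x i = tnth y i -> tnth x j = tnth y j -> y \in subcube [set i; j] a -> x = y.
  move=> yi yj /in_subcube Hy; apply: eq_from_tnth => k.
  have [->//|ki] := eqVneq k i; have [->//|kj] := eqVneq k j.
  by rewrite H ?Hy // !inE negb_or ki.
have ji : j == i = false by rewrite eq_sym (negbTE ij).
have [xi|xi] := eqVneq (tnth x i) (tnth a i); have [xj|xj] := eqVneq (tnth x j) (tnth a j).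
- by rewrite (E a xi xj (mem_subcube _ _)) inE eqxx.
- have -> : x = flip j a; last by rewrite !inE eqxx !orbT.
  apply: E; rewrite ?subcube_flip ?mem_subcube // tnth_flip ?(negbTE ij) ?eqxx //.
  by move: xj; case: (tnth x j); case: (tnth a j).
- have -> : x = flip i a; last by rewrite !inE eqxx !orbT.
  apply: E; rewrite ?subcube_flip ?mem_subcube // tnth_flip ?ji ?eqxx //.
  by move: xi; case: (tnth x i); case: (tnth a i).
have -> : x = flip j (flip i a); last by rewrite !inE eqxx !orbT.
apply: E; rewrite ?subcube_flip ?mem_subcube // !tnth_flip ?ji ?(negbTE ij) ?eqxx //.
  by move: xi; case: (tnth x i); case: (tnth a i).
by move: xj; case: (tnth x j); case: (tnth a j).
Qed.

(** The four directions [i], [j], [l], [r] around the cycle cancel out, and consecutive ones differ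
    because [g] is injective. Hence [r = j] and [l = i]. *)
Lemma square_subcube (g : 'I_4 -> cube) : injective g ->
  (forall i : 'I_4, cube_adj (g i) (g (ordS i))) ->
  exists f : {set 'I_n} * cube, #|f.1| <= 2 /\ [set g i | i : 'I_4] = subcube f.1 f.2.
Proof.
move=> injg adjg.
pose o k (hk : k < 4) := Ordinal hk.
have step k (hk : k < 4) k' (hk' : k' < 4) : k' = k.+1 %% 4 ->
    exists i, g (o k' hk') = flip i (g (o k hk)).
  move=> E; have /cube_adjP[i Ei] := adjg (o k hk); exists i; rewrite -Ei.
  by congr g; apply: val_inj.
have [i E1] := step 0 isT 1 isT erefl; have [j E2] := step 1 isT 2 isT erefl.
have [l E3] := step 2 isT 3 isT erefl; have [r E4] := step 3 isT 0 isT erefl.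
have ij : i != j.
  by apply/eqP => ij; have := E2; rewrite E1 ij flipK => /injg.
have lj : j != l.
  by apply/eqP => jl; have := E3; rewrite E2 jl flipK => /injg.
have ji : j == i = false by rewrite eq_sym (negbTE ij).
have E4' : g (o 0 isT) = flip r (flip l (flip j (flip i (g (o 0 isT))))).
  by rewrite -E1 -E2 -E3.
have rj : j == r.
  move/(congr1 (fun z => tnth z j)): E4'; rewrite !tnth_flip eqxx (negbTE lj) ji.
  by case: (j == r); case: (tnth _ j).
have il : i == l.
  move/(congr1 (fun z => tnth z i)): E4'; rewrite !tnth_flip eqxx -(eqP rj) (negbTE ij).
  by case: (i == l); case: (tnth _ i).
exists ([set i; j], g (o 0 isT)) => /=; split; first by rewrite cards2 ij.
apply/eqP; rewrite eqEcard card_subcube card_imset // card_ord cards2 ij andbT.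
have Eg k (hk : k < 4) (p : 'I_4) : val p = k -> g p = g (o k hk).
  by move=> E; congr g; apply: val_inj.
apply/subsetP => _ /imsetP[[k hk] _ ->]; rewrite subcube_pair //.
case: k hk => [|[|[|[|//]]]] hk.
- by rewrite (Eg 0 isT) // inE eqxx.
- by rewrite (Eg 1 isT) // E1 !inE eqxx orbT.
- by rewrite (Eg 2 isT) // E2 E1 !inE eqxx !orbT.
by rewrite (Eg 3 isT) // E3 E2 E1 -(eqP il) flipC flipK !inE eqxx !orbT.
Qed.

Lemma square_cut_lower (F : {set subgraph (hypercube n)}) : 4 <= n ->
  structure_cut (cycle_graph 4) F -> n - 2 <= #|F|.
Proof.
move=> n4 cut; rewrite leqNgt; apply/negP => lt.
have [face Hf] : exists face : subgraph (hypercube n) -> {set 'I_n} * cube,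
    forall S, S \in F -> #|(face S).1| <= 2 /\ sub_verts S = subcube (face S).1 (face S).2.
  apply: (@fin_all_exists (subgraph (hypercube n)) (fun=> ({set 'I_n} * cube)%type)
    (fun S f => S \in F -> #|f.1| <= 2 /\ sub_verts S = subcube f.1 f.2)) => S.
  have [SF|_] := boolP (S \in F); last first.
    (* An arbitrary value for subgraphs outside [F]. *)
    by exists (set0, [tuple false | i < n]).
  have [g [injg adjg E]] := cycle_param (isT : 3 <= 4) (cut.1 S SF).
  have [f [f2 Ef]] := square_subcube injg adjg.
  by exists f => _; rewrite E.
pose fs := [seq face T | T <- enum F].
have fs2 : all (fun f : {set 'I_n} * cube => #|f.1| <= 2) fs.
  by apply/allP => _ /mapP[S + ->]; rewrite mem_enum => /Hf[].
have sfs : size fs = #|F| by rewrite size_map -cardE.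
have X : family_verts F = subcubes fs.
  apply/setP => x; rewrite in_subcubes has_map; apply/bigcupP/hasP => -[S SF xS].
    by exists S; rewrite ?mem_enum //=; have [_ <-] := Hf S SF.
  by rewrite mem_enum in SF; exists S => //; have [_ ->] := Hf S SF.
pose a : cube := [tuple false | i < n].
apply: (not_cut _ _ cut).
  rewrite X (_ : ~: subcubes fs = subcube setT a :\: subcubes fs); last by rewrite subcube_setT setTD.
  apply: connected_subcubes => //; rewrite cardsT card_ord.
  have := count_size (meets (subcube [set: 'I_n] a)) fs; rewrite sfs.
  by move: lt n4; move: #|_| (count _ _) => A B; clear; lia.
rewrite X -[subcubes fs](setIT _).
have := card_subcubes setT fs2; have := count_size (meets setT) fs; rewrite sfs.
have : 4 * (n - 3) + 1 < 2 ^ n.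
  have [d ->] : exists d, n = d + 4 by exists (n - 4); lia.
  rewrite expnD; have := ltn_expl d (isT : 1 < 2); lia.
move: lt; move: #|_| (count _ _) (2 ^ n) #|_| => A B C D; clear; lia.
Qed.

(** The parallel copies of one square, shifted along each of the other [n - 2] directions, form the
    whole neighbourhood of that square and cut it off. *)
Lemma square_cut_upper : 4 <= n ->
  exists F : {set subgraph (hypercube n)}, structure_cut (cycle_graph 4) F /\ #|F| <= n - 2.
Proof.
move=> n4; pose i0 := Ordinal (leq_trans (isT : 0 < 4) n4).
pose i1 := Ordinal (leq_trans (isT : 1 < 4) n4).
pose i2 := Ordinal (leq_trans (isT : 2 < 4) n4).
pose i3 := Ordinal (leq_trans (isT : 3 < 4) n4).
pose z : cube := [tuple false | i < n].
have zE k : tnth z k = false by rewrite tnth_mktuple.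
have i01 : i0 != i1 by [].
have [T HT] : exists T : 'I_n -> subgraph (hypercube n), forall j,
    isomorphic (graph_of_subgraph (T j)) (cycle_graph 4) /\
    sub_verts (T j) = subcube [set i0; i1] (flip j z).
  apply: (@fin_all_exists 'I_n (fun=> subgraph (hypercube n)) (fun j S =>
    isomorphic (graph_of_subgraph S) (cycle_graph 4) /\
    sub_verts S = subcube [set i0; i1] (flip j z))) => j; set b := flip j z.
  have sz : #|subcube [set i0; i1] b| = 4 by rewrite card_subcube cards2 i01.
  have [||S [iso SV]] := @cycle_subgraph_seq (hypercube n)
      [:: b; flip i0 b; flip i1 (flip i0 b); flip i1 b] isT.
  - apply/card_uniqP; rewrite -[RHS]/4 -sz; apply: eq_card => x.
    by rewrite subcube_pair.
  - have down k y : cube_adj (flip k y) y by rewrite cube_adj_sym cube_adj_flip.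
    rewrite /=; apply/and5P; split.
    + exact: cube_adj_flip.
    + exact: cube_adj_flip.
    + rewrite flipC; exact: down.
    + exact: down.
    by [].
  by exists S; split=> //; apply/setP => x; rewrite SV subcube_pair.
exists [set T j | j in [set j : 'I_n | 1 < j]]; split; last first.
  apply: leq_trans (leq_imset_card _ _) _.
  have -> : [set j : 'I_n | 1 < j] = ~: [set i0; i1].
    by apply/setP => -[[|[|k]] hk]; rewrite !inE -!val_eqE.
  by rewrite -[n in X in _ <= X]card_ord -(cardsC [set i0; i1]) cards2 i01 addKn.
split; first by move=> _ /imsetP[j _ ->]; have [] := HT j.
left; rewrite /remove_family; set X := family_verts _.
have XP x : x \in X -> exists2 j : 'I_n, 1 < j & x \in subcube [set i0; i1] (flip j z).
  case/bigcupP => _ /imsetP[j + ->]; rewrite inE => j1 xT; exists j => //.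
  by have [_ <-] := HT j.
have big (j : 'I_n) : 1 < j -> j \notin [set i0; i1].
  by move=> j1; rewrite !inE -!val_eqE negb_or /=; case: (val j) j1 => [|[|]].
(* This vertex differs from the square at [z] in two directions, so it lies on no shifted copy; here
   [4 <= n] provides [i2] and [i3]. *)
pose w := flip i2 (flip i3 z).
have z2 : i2 \notin [set i0; i1] by apply: big.
have z3 : i3 \notin [set i0; i1] by apply: big.
apply: (@disconnected_induced (hypercube n) (~: X) (subcube [set i0; i1] z) z w).
- move=> u v _ vX; rewrite -[adj u v]/(cube_adj u v) => /cube_adjP[l Ev] uz.
  have [l01|l01] := boolP (l \in [set i0; i1]); first by rewrite Ev subcube_flip.
  move: vX; rewrite in_setC => /negP[]; apply/bigcupP; exists (T l).
    apply: imset_f; rewrite inE; move: l01; rewrite !inE -!val_eqE negb_or /=.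
    by case: (val l) => [|[|]].
  have [_ ->] := HT l; apply/in_subcube => k kS; rewrite Ev !tnth_flip.
  by rewrite (in_subcube _ _ _ uz).
- rewrite inE; apply/negP => /XP[j j1 /in_subcube/(_ j (big j j1))].
  by rewrite tnth_flip zE eqxx.
- exact: mem_subcube.
- rewrite inE; apply/negP => /XP[j j1 /in_subcube H].
  have := H i2 z2; have := H i3 z3; rewrite !tnth_flip !zE !eqxx /=.
  by move=> /esym; rewrite addbF => /eqP <- /esym; rewrite addbF.
apply/negP => /in_subcube/(_ i2 z2); by rewrite !tnth_flip zE eqxx.
Qed.

End HypercubeCycles.

(** * Long cycles through neighbours of the origin *)

Section LongCycles.
Variable n : nat.
Local Notation cube := (n.-tuple bool).
Local Notation cadj := (@cube_adj n).

(** Adjacent vertices of a subcube are joined by paths with any even number [s] of vertices up to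
    all of them. If [s] exceeds half of the subcube, a Hamiltonian path of one half has its first
    edge replaced by a detour through the other half. *)
Lemma cube_path d (R : {set 'I_n}) (x : cube) (i : 'I_n) s :
  #|R| = d -> i \in R -> 2 <= s <= 2 ^ d -> ~~ odd s ->
  exists p, [/\ path cadj x p, last x p = flip i x, uniq (x :: p), size (x :: p) = s &
    {subset x :: p <= subcube R x}].
Proof.
elim: d R x i s => [|d IH] R x i s cR iR /andP[s2 sd] os.
  by move/eqP: cR; rewrite cards_eq0 => /eqP R0; rewrite R0 inE in iR.
have base : s = 2 -> exists p, [/\ path cadj x p, last x p = flip i x, uniq (x :: p),
    size (x :: p) = s & {subset x :: p <= subcube R x}].
  move=> ->; exists [:: flip i x]; split=> //=.
  - by rewrite cube_adj_flip.
  - by rewrite inE eq_sym flip_neq.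
  by move=> y; rewrite !in_cons in_nil orbF => /orP[] /eqP ->; rewrite ?subcube_flip ?mem_subcube.
have [/eqP Ri0 | /set0Pn[c]] := boolP (R :\ i == set0).
  apply: base; apply/eqP; rewrite eqn_leq s2 andbT; apply: leq_trans sd _.
  by move: cR; rewrite (cardsD1 i) iR Ri0 cards0 => -[<-].
rewrite in_setD1 => /andP[ci cR'].
have cRc : #|R :\ c| = d by move: cR; rewrite (cardsD1 c) cR' => -[].
have iRc : i \in R :\ c by rewrite in_setD1 eq_sym ci.
have sR y z : y \in subcube (R :\ c) z -> y \in subcube R z by apply: (subsetP (subcubeD1_subset _ _ _)).
have [le|gt] := leqP s (2 ^ d).
  have [|p [? ? ? ? ps]] := IH _ x i s cRc iRc _ os; first by rewrite s2.
  by exists p; split=> // y /ps /sR.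
have d0 : 0 < d by rewrite -cRc; apply/card_gt0P; exists i.
have ev : ~~ odd (2 ^ d) by case: d d0 {IH cR cRc sd gt} => // d _; rewrite expnS mul2n odd_double.
have d2 : 2 <= 2 ^ d by rewrite -[2]/(2 ^ 1) leq_exp2l.
have [|p [pp pl pu psz ps]] := IH _ x i (2 ^ d) cRc iRc _ ev; first by rewrite d2 leqnn.
case: p pp pl pu psz ps => [|b p]; first by move=> _ _ _ E; rewrite -E in d2.
move=> /= /andP[/cube_adjP[k Eb] pp] pl /andP[xu pu] [psz] ps.
have kR : k \in R :\ c.
  apply: contraT => kR; have /in_subcube/(_ k kR) : b \in subcube (R :\ c) x.
    by apply: ps; rewrite !in_cons eqxx orbT.
  by rewrite Eb tnth_flip eqxx; case: (tnth x k).
(* The first edge runs from [x] to [b = flip k x]; the detour [q] joins their partners across [c]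
   and supplies the missing [s - 2 ^ d] vertices. *)
have [||q [qp ql qu qsz qs]] := IH _ (flip c x) k (s - 2 ^ d) cRc kR.
- apply/andP; split; last by rewrite leq_subLR addnn -mul2n -expnS.
  by move: os ev gt; move: (2 ^ d) => e; clear; lia.
- by rewrite oddB ?(ltnW gt) // (negbTE os) (negbTE ev).
exists (flip c x :: q ++ b :: p); split.
- rewrite /= cube_adj_flip cat_path qp ql /= Eb -Eb pp andbT.
  by rewrite flipC cube_adj_sym -Eb cube_adj_flip.
- by rewrite /= last_cat.
- have nc y : y \in flip c x :: q -> y \in x :: b :: p -> false.
    move=> /qs /in_subcube/(_ c) yc /ps /in_subcube/(_ c) yc'.
    have cN : c \notin R :\ c by rewrite !inE eqxx.
    by move: (yc cN); rewrite (yc' cN) tnth_flip eqxx; case: (tnth x c).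
  have U : uniq ((flip c x :: q) ++ (b :: p)).
    rewrite cat_uniq qu [uniq (b :: p)]pu andbT.
    by apply/hasPn => y yp; apply/negP => /nc; rewrite in_cons yp orbT => /(_ isT).
  have xN : x \notin (flip c x :: q) ++ (b :: p).
    rewrite mem_cat negb_or [x \notin b :: p]xu andbT.
    by apply/negP => /nc; rewrite in_cons eqxx => /(_ isT).
  exact: (introT andP (conj xN U)).
- move: qsz psz gt => /=; rewrite size_cat /=.
  by move: (2 ^ d) (size q) (size p) => e u w; clear; lia.
move=> y; rewrite -[_ :: q ++ _]/((flip c x :: q) ++ (b :: p)) in_cons mem_cat.
case/or3P=> [/eqP -> | /qs/sR | yp].
- exact: mem_subcube.
- by rewrite subcube_flip_base.
by apply: sR; apply: ps; rewrite in_cons yp orbT.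
Qed.

Definition origin : cube := [tuple false | _ < n].

Lemma tnth_origin k : tnth origin k = false.
Proof. by rewrite tnth_mktuple. Qed.

(** Position [2a] holds the unit vector of [f a], and position [2a + 1] the sum of those of [f a]
    and [f (a + 1)], indices modulo [r]; this is a closed walk of length [2r]. *)
Definition zigzag (f : nat -> 'I_n) r k : cube :=
  if odd k then flip (f k./2) (flip (f (k./2.+1 %% r)) origin) else flip (f k./2) origin.

Lemma zigzag_double f r a : zigzag f r a.*2 = flip (f a) origin.
Proof. by rewrite /zigzag odd_double doubleK. Qed.

Lemma zigzag_doubleS f r a :
  zigzag f r a.*2.+1 = flip (f a) (flip (f (a.+1 %% r)) origin).
Proof. by rewrite /zigzag /= odd_double uphalf_double. Qed.

Lemma double_cases k : exists a, k = a.*2 \/ k = a.*2.+1.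
Proof.
by exists k./2; rewrite -[in X in X \/ _](odd_double_half k) -[in X in _ \/ X](odd_double_half k);
  case: (odd k); [right | left]; rewrite ?add1n ?add0n ?doubleK //= ?uphalf_double.
Qed.

Lemma zigzag_adj f r k : 0 < r -> k < r.*2 ->
  cadj (zigzag f r k) (zigzag f r (k.+1 %% r.*2)).
Proof.
move=> r0; have [a [->|->]] := double_cases k => lt.
  have lt' : a.*2.+1 < r.*2 by rewrite ltn_Sdouble -ltn_double.
  by rewrite modn_small // zigzag_double zigzag_doubleS flipC cube_adj_flip.
have ar : a < r by rewrite -ltn_Sdouble.
have -> : a.*2.+2 %% r.*2 = (a.+1 %% r).*2 by rewrite -doubleS -!muln2 muln_modl.
by rewrite zigzag_double zigzag_doubleS cube_adj_sym cube_adj_flip.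
Qed.

Lemma parity_zigzag f r k : parity (zigzag f r k) = ~~ odd k.
Proof.
have p0 : parity origin = false.
  by rewrite /parity big1 // => i _; rewrite tnth_origin.
by rewrite /zigzag; case: (odd k); rewrite !parity_flip p0.
Qed.

(** Parity separates even from odd positions. For [r >= 3], a pair of cyclically consecutive indices
    determines which of them comes first. *)
Lemma zigzag_inj f r : 3 <= r -> {in gtn r &, injective f} ->
  {in gtn r.*2 &, injective (zigzag f r)}.
Proof.
move=> r3 injf k l kr lr E; have := congr1 (@parity n) E.
rewrite !parity_zigzag => /negb_inj; move: kr lr E; rewrite !inE.
have [a [->|->]] := double_cases k; have [b [->|->]] := double_cases l;
  rewrite /= ?odd_double // ?ltn_double ?ltn_Sdouble => ar br + _.
  by rewrite !zigzag_double => /flip_injl/injf ->.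
rewrite !zigzag_doubleS => E; congr (_.*2.+1).
have r0 : 0 < r by apply: leq_trans r3.
have fE c e : c < r -> e < r -> (f c == f e) = (c == e).
  by move=> cr er; apply/eqP/eqP => [/injf|->] //; apply.
have mr c : c.+1 %% r < r by rewrite ltn_mod.
have := congr1 (fun z => tnth z (f a)) E; have := congr1 (fun z => tnth z (f b)) E.
rewrite !tnth_flip !tnth_origin !fE ?mr // !modn_succ // !eqxx !addbF.
rewrite (eq_sym b a); have [//|ab] := eqVneq a b.
by move: ar br r3 ab; clear; do 8?case: eqP => //=; lia.
Qed.

(** The zigzag has length [2r]. To gain [s] vertices, its first edge is replaced by a path through
    the subcube where the coordinates [f 0] and [f 2] are both 1. *)
Lemma star_cycle (f : nat -> 'I_n) r s : 4 <= r -> {in gtn r &, injective f} ->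
  ~~ odd s -> s <= 2 ^ (n - 2) ->
  exists c : seq cube, [/\ uniq c, cycle cadj c, size c = r.*2 + s, origin \notin c &
    forall a, a < r -> flip (f a) origin \in c].
Proof.
move=> r4 injf os sn; have r0 : 0 < r by apply: leq_trans r4.
pose c := mkseq (zigzag f r) r.*2.
have cyc : cycle cadj c by apply: cycle_mkseq => k; apply: zigzag_adj.
have uc : uniq c by apply/mkseq_uniqP; apply: zigzag_inj => //; apply: ltnW.
have sc : size c = r.*2 by rewrite size_mkseq.
have uin a : a < r -> flip (f a) origin \in c.
  move=> ar; apply/mapP; exists a.*2; last by rewrite zigzag_double.
  by rewrite mem_iota ltn_double.
have memc y : y \in c -> exists2 k, k < r.*2 & y = zigzag f r k.
  by case/mapP => k; rewrite mem_iota => kr ->; exists k.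
have cf a b : a < r -> b < r -> a != b -> f a != f b.
  by move=> ar br; apply: contraNneq => /injf ->.
have oc : origin \notin c.
  apply/negP => /memc[k kr]; have [a [Ek|Ek]] := double_cases k; rewrite {}Ek in kr *.
    by rewrite zigzag_double => /esym/eqP; rewrite flip_neq.
  have ar : a < r by rewrite -ltn_Sdouble.
  have aa : (f a == f (a.+1 %% r)) = false.
    apply: negbTE; apply: cf; rewrite ?ltn_mod // modn_succ //.
    by move: r4; clear; do 2?case: eqP => //=; lia.
  move/(congr1 (fun z => tnth z (f a))).
  by rewrite zigzag_doubleS !tnth_flip tnth_origin eqxx aa.
have [s0|s0] := posnP s; first by exists c; rewrite s0 addn0.
have lt k : k < 4 -> k < r by move=> ?; apply: leq_trans r4.
pose R := ~: [set f 0; f 2].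
have cR : #|R| = n - 2.
  have := cardsC [set f 0; f 2]; rewrite cards2 cf ?lt // card_ord -/R => E.
  by rewrite -[in RHS]E addKn.
have f1R : f 1 \in R by rewrite !inE negb_or !cf ?lt.
pose x := flip (f 2) (flip (f 0) origin).
have [|p [pp pl pu psz ps]] := cube_path x cR f1R _ os.
  by rewrite sn andbT; case: (s) s0 os => [|[|]].
(* A zigzag vertex with both coordinates 1 would make 0 and 2 cyclically consecutive modulo [r],
   which [4 <= r] excludes. *)
have disj y : y \in subcube R x -> y \notin c.
  move=> /in_subcube yx; apply/negP => /memc[k kr Ey].
  have y0 : tnth y (f 0) = true.
    by rewrite yx ?inE ?eqxx // !tnth_flip tnth_origin eqxx (negbTE (cf _ _ _ _ _)) ?lt.
  have y2 : tnth y (f 2) = true.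
    by rewrite yx ?inE ?eqxx ?orbT // !tnth_flip tnth_origin eqxx (negbTE (cf _ _ _ _ _)) ?lt.
  have l2 := lt 2 isT.
  have fE a b : a < r -> b < r -> (f a == f b) = (a == b).
    by move=> ar br; apply/eqP/eqP => [/injf|->] //; apply.
  move: y0 y2; rewrite {}Ey; have [a [Ek|Ek]] := double_cases k; rewrite {}Ek in kr *.
    have ar : a < r by rewrite -ltn_double.
    rewrite zigzag_double !tnth_flip !tnth_origin !fE //.
    by case: a {kr ar}.
  have ar : a < r by rewrite -ltn_Sdouble.
  rewrite zigzag_doubleS !tnth_flip !tnth_origin !fE ?ltn_mod // modn_succ //.
  by move: ar r4; clear; do 5?case: eqP => //=; lia.
case Ec : c => [|u c']; first by move: sc r0; rewrite Ec /= -double_gt0 => <-.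
have u0 : u = flip (f 0) origin.
  have E : nth u c 0 = zigzag f r 0 by rewrite nth_mkseq ?double_gt0.
  by move: E; rewrite Ec (zigzag_double f r 0).
(* The path from [x] ends at [flip (f 1) x], which is adjacent to the second zigzag vertex along
   [f 2]. *)
exists (u :: (x :: p) ++ c'); rewrite Ec in cyc uc sc oc uin disj; split.
- move: uc => /= /andP[uc' uc].
  have U : uniq ((x :: p) ++ c').
    rewrite cat_uniq pu uc andbT; apply/hasPn => y yc.
    by apply/negP => /ps/disj; rewrite in_cons yc orbT.
  have uN : u \notin (x :: p) ++ c'.
    rewrite mem_cat negb_or uc' andbT.
    by apply/negP => /ps/disj; rewrite in_cons eqxx.
  exact: (introT andP (conj uN U)).
- have c1 : exists v c'', c' = v :: c'' /\ v = flip (f 1) (flip (f 0) origin).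
    have E : nth u c 1 = zigzag f r 1 by rewrite nth_mkseq //; move: r0; clear; lia.
    case: c' Ec {cyc uc oc uin disj} sc => [|v c''] Ec sc.
      by move: r0 sc; case: (r) => // r' _ /=; rewrite doubleS.
    exists v, c''; split=> //; move: E; rewrite Ec /= => ->.
    by rewrite (zigzag_doubleS f r 0) modn_small ?lt // flipC.
  case: c1 cyc => v [c'' [-> Ev]] /= /andP[_ cyc].
  rewrite {1}u0 cube_adj_flip rcons_cat cat_path pp pl /= cyc andbT.
  by rewrite /x flipC Ev cube_adj_sym; apply/cube_adjP; exists (f 2); rewrite flipC.
- by rewrite /= size_cat -sc /=; move: psz => /= <-; lia.
- rewrite in_cons mem_cat negb_or negb_or; move: oc; rewrite in_cons negb_or => /andP[-> ->].
  rewrite andbT; apply/negP => /ps /in_subcube/(_ (f 0)).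
  rewrite !inE eqxx => /(_ isT); rewrite !tnth_flip tnth_origin eqxx.
  by rewrite (negbTE (cf _ _ _ _ _)) ?lt.
move=> a /uin; rewrite !in_cons mem_cat => /orP[-> // | ->]; by rewrite !orbT.
Qed.

End LongCycles.

(** * Upper bound: isolating the origin *)

(** The hypothesis on [t] says that [t] is the ceiling of [n / q] with [q = 2 ^ m.-1]. Blocks of
    consecutive directions are shared out among [t] cycles, which together contain all neighbours of
    the origin. *)
Lemma star_cut_upper n m t : 3 <= m -> m <= n - 2 ->
  n <= t * 2 ^ m.-1 < n + 2 ^ m.-1 ->
  exists F : {set subgraph (hypercube n)},
    structure_cut (cycle_graph (2 ^ m)) F /\ #|F| <= t.
Proof.
move=> m3 mn /andP[nt tn]; set q := 2 ^ m.-1 in nt tn *.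
have q2 : 2 ^ m = q.*2 by rewrite -mul2n -expnS prednK // (leq_trans _ m3).
have q4 : 4 <= q by rewrite -[4]/(2 ^ 2) leq_exp2l //; move: m3; clear; lia.
have n4 : 4 <= n by move: m3 mn; clear; lia.
have n0 : 0 < n by apply: leq_trans n4.
have qn : q.*2 <= 2 ^ (n - 2) by rewrite -q2 leq_exp2l.
(* Reduction modulo [n] lets the last block wrap around; directions within a block of length at most
   [n] stay distinct. *)
pose f j k := Ordinal (ltn_pmod (j * q + k) n0).
have injf j r : r <= n -> {in gtn r &, injective (f j)}.
  move=> rn k l; rewrite !inE => kr lr /(congr1 val)/eqP /=.
  by rewrite eqn_modDl !modn_small ?(leq_trans _ rn) // => /eqP.
(* Each cycle visits [r = min(q, n)] neighbours of the origin, and the detour has the [s = 2q - 2r]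
   vertices still needed. *)
have [r [r4 rn rq [s os sn]]] : exists r, [/\ 4 <= r, r <= n, q.*2 >= r.*2 /\ (r = q \/ r = n) &
    exists2 s, ~~ odd s /\ r.*2 + s = q.*2 & s <= 2 ^ (n - 2)].
  have [le|gt] := leqP q n; [exists q | exists n]; split=> //.
  - by split=> //; left.
  - by exists 0; rewrite ?addn0.
  - by split; [rewrite leq_double ltnW | right].
  exists (q.*2 - n.*2); last exact: leq_trans (leq_subr _ _) qn.
  by rewrite oddB ?leq_double 1?ltnW // !odd_double subnKC ?leq_double 1?ltnW.
have [T HT] : exists T : 'I_t -> subgraph (hypercube n), forall j : 'I_t,
    [/\ isomorphic (graph_of_subgraph (T j)) (cycle_graph (2 ^ m)),
      #|sub_verts (T j)| = 2 ^ m, origin n \notin sub_verts (T j) &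
      forall a, a < r -> flip (f j a) (origin n) \in sub_verts (T j)].
  apply: (@fin_all_exists 'I_t (fun=> subgraph (hypercube n)) (fun j S =>
    [/\ isomorphic (graph_of_subgraph S) (cycle_graph (2 ^ m)),
      #|sub_verts S| = 2 ^ m, origin n \notin sub_verts S &
      forall a, a < r -> flip (f j a) (origin n) \in sub_verts S])) => j.
  have [c [uc cyc sc oc cf]] := star_cycle r4 (injf j r rn) os.1 sn.
  rewrite os.2 -q2 in sc.
  have c3 : 3 <= size c by rewrite sc q2; move: q4; clear; lia.
  have [S [iso SV]] := @cycle_subgraph_seq (hypercube n) c c3 uc cyc.
  exists S; rewrite -{1}sc; split=> //.
  - by rewrite -sc -(card_uniqP uc); apply: eq_card.
  - by rewrite SV.
  by move=> a /cf; rewrite SV.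
pose F := [set T j | j : 'I_t].
(* Only an inequality is claimed, since different indices might give the same subgraph. *)
have cF : #|F| <= t by apply: leq_trans (leq_imset_card _ _) _; rewrite card_ord.
exists F; split=> //; split; first by move=> _ /imsetP[j _ ->]; have [] := HT j.
left; rewrite /remove_family; set X : {set n.-tuple bool} := family_verts F.
have nbr l : flip l (origin n) \in X.
  have Xin (j : 'I_t) a : a < r -> f j a = l -> flip l (origin n) \in X.
    move=> ar <-; have [_ _ _ /(_ a ar) H] := HT j.
    by apply/bigcupP; exists (T j); first exact: imset_f.
  have q0 : 0 < q by apply: leq_trans q4.
  (* Direction [l] belongs to block [l %/ q] when [r = q]; when [r = n], the first cycle already
     contains every neighbour. *)
  have [_ [rq' | rn']] := rq.
    have jt : l %/ q < t by rewrite ltn_divLR // (leq_trans (ltn_ord l)).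
    apply: (Xin (Ordinal jt) (l %% q)); first by rewrite rq' ltn_mod.
    by apply: val_inj; rewrite /= -divn_eq modn_small.
  have t0 : 0 < t by rewrite lt0n; apply: contraTneq nt => ->; rewrite mul0n -ltnNge.
  apply: (Xin (Ordinal t0) l); first by rewrite rn'.
  by apply: val_inj; rewrite /= mul0n add0n modn_small.
have cX : #|X| <= t * q.*2.
  apply: (@leq_trans (#|F| * q.*2)); last by rewrite leq_mul2r cF orbT.
  apply: leq_trans (@card_family_verts n F predT q.*2 _).
    by apply: subset_leq_card; apply/subsetP => x xX; rewrite inE xX.
  move=> _ /imsetP[j _ ->]; rewrite -q2; have [_ <- _ _] := HT j.
  by apply: subset_leq_card; apply/subsetP => x; rewrite inE => /andP[].
(* The cycles cover at most [2tq < 2n + 2q] vertices, and both [n] and [2q] are at most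
   [2 ^ (n - 2)], so a vertex other than the origin survives. *)
have [y yX yo] : exists2 y, y \notin X & y != origin n.
  have lt : #|origin n |: X| < 2 ^ n.
    apply: (@leq_ltn_trans #|X|.+1); first by rewrite cardsU1; case: (_ \notin _); rewrite ?add1n.
    have n2 : n <= 2 ^ (n - 2).
      have [d ->] : exists d, n = d + 4 by exists (n - 4); rewrite subnK.
      by rewrite -addnBA // expnD -[2 ^ (4 - 2)]/4; have := ltn_expl d (isT : 1 < 2); move: (2 ^ d); clear; lia.
    have e : 2 ^ n = 4 * 2 ^ (n - 2) by rewrite -[4]/(2 ^ 2) -expnD subnKC // (leq_trans _ n4).
    move: cX tn n2 qn n4; rewrite e -muln2 mulnA; move: (t * q) (2 ^ (n - 2)) #|_| => A B C.
    by clear; lia.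
  have : 0 < #|~: (origin n |: X)|.
    by rewrite -(ltn_add2l #|origin n |: X|) cardsC card_cube addn0.
  by case/card_gt0P => y; rewrite in_setC in_setU1 negb_or => /andP[? ?]; exists y.
apply: (@disconnected_induced (hypercube n) (~: X) [set (origin n : hypercube n)] (origin n) y).
- move=> u v _ vX; rewrite -[adj u v]/(cube_adj u v) => /cube_adjP[l Ev] /set1P uo.
  by move: vX; rewrite in_setC Ev uo nbr.
- rewrite in_setC; apply/bigcupP => -[_ /imsetP[j _ ->]].
  by have [_ _ /negP] := HT j.
- exact: set11.
- by rewrite in_setC.
by rewrite in_set1.
Qed.

(** * The ceiling and the assembly of the cases *)

Import Order.TTheory GRing.Theory Num.Theory.

(** The ceiling is nonnegative, so the absolute value in [ceil_ratio] changes nothing, and comparing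
    with [k] reduces to natural numbers. *)
Lemma ceil_ratio_le a b k : 0 < b -> (ceil_ratio a b <= k) = (a <= k * b).
Proof.
move=> b0; rewrite /ceil_ratio; set x : rat := (_ / _)%R.
have b0' : (0 < b%:R :> rat)%R by rewrite ltr0n.
have x0 : (0 <= Num.ceil x)%R.
  by rewrite ceil_ge0 (@lt_le_trans _ _ 0%R) // divr_ge0 ?ler0n.
by rewrite -lez_nat gez0_abs // ceil_le_int ler_pdivrMr // -natrM ler_nat.
Qed.

Theorem theorem27 (n m : nat) (hn : 4 <= n) (hm2 : 2 <= m) (hmn : m <= n - 2) :
  ((n = 4 \/ n = 5) \/ m = 2 ->
     kappa_eq (hypercube n) (cycle_graph (2 ^ m)) (n - m)) /\
  (6 <= n -> 3 <= m ->
     kappa_eq (hypercube n) (cycle_graph (2 ^ m)) (ceil_ratio n (2 ^ (m - 1))) /\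
     ceil_ratio n (2 ^ (m - 1)) < n - m).
Proof.
have kappaI H k : (forall F : {set subgraph (hypercube n)}, structure_cut H F -> k <= #|F|) ->
    (exists F : {set subgraph (hypercube n)}, structure_cut H F /\ #|F| <= k) ->
    kappa_eq (hypercube n) H k.
  move=> lb [F [cut le]]; split=> //; exists F; split=> //.
  by apply/eqP; rewrite eqn_leq le lb.
have q0 : 0 < 2 ^ (m - 1) by rewrite expn_gt0.
(* This formula holds for every [m >= 3], in particular for [n = 5] and [m = 3]. *)
have ceil : 3 <= m ->
    kappa_eq (hypercube n) (cycle_graph (2 ^ m)) (ceil_ratio n (2 ^ (m - 1))).
  move=> m3; have e : 2 ^ m = 2 * 2 ^ (m - 1) by rewrite -expnS subn1 prednK // ltnW.
  have q2 : 2 <= 2 ^ (m - 1) by rewrite -[2]/(2 ^ 1) leq_exp2l //; lia.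
  apply: kappaI => [F|].
    by rewrite e ceil_ratio_le //; apply: cycle_cut_lower.
  apply: star_cut_upper => //; rewrite -subn1 -ceil_ratio_le // leqnn /=.
  case E : (ceil_ratio n (2 ^ (m - 1))) => [|t]; first by rewrite mul0n addn_gt0 q0 orbT.
  by rewrite mulSn addnC ltn_add2r ltnNge -ceil_ratio_le // E ltnn.
split=> [cases | n6 m3]; last first.
  split; first exact: ceil.
  have -> : (ceil_ratio n (2 ^ (m - 1)) < n - m) = (ceil_ratio n (2 ^ (m - 1)) <= n - m - 1).
    have : 0 < n - m by lia.
    by case: (n - m) => // k _; rewrite ltnS subSS subn0.
  rewrite ceil_ratio_le //.
  (* It remains to see that [n <= (n - m - 1) * 2 ^ (m - 1)]. For [m = 3] this reads
     [n <= 4 * (n - 4)], true from [n = 6] on; for [m >= 4] the bound [d < 2 ^ d] suffices. *)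
  have [E | m4] := eqVneq m 3; first by rewrite E -[2 ^ _]/4; lia.
  have [d E] : exists d, m = d + 4 by exists (m - 4); lia.
  have -> : 2 ^ (m - 1) = 8 * 2 ^ d by rewrite -[8]/(2 ^ 3) -expnD; congr (2 ^ _); lia.
  have := ltn_expl d (isT : 1 < 2); move: (2 ^ d) => e de.
  have [r Er] : exists r, n = m + 2 + r by exists (n - m - 2); lia.
  have -> : n - m - 1 = r.+1 by lia.
  rewrite mulSn Er E; nia.
have [m2 | m2] := eqVneq m 2.
  rewrite m2 -[2 ^ 2]/4; apply: kappaI => [F|]; last exact: square_cut_upper.
  exact: square_cut_lower.
have m3 : 3 <= m by lia.
(* With [3 <= m <= n - 2] and [n] at most 5, only [n = 5], [m = 3] is left, where both formulas give
   2. *)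
have n5 : n = 5 by lia.
have {m2 hm2 cases} E : m = 3 by lia.
suff -> : n - m = ceil_ratio n (2 ^ (m - 1)) by exact: ceil.
by rewrite n5 E; apply/eqP; rewrite eqn_leq ceil_ratio_le.
Qed.
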